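(* Let $\mathcal H=\{(X,Y)\in\mathbb R^2:\ |X|\le\tfrac12,\ \sqrt3\,|Y|+|X|\le1\}$. Then $$\int_{t>0,\ (X,Y)\in\mathcal H,\ 1-1/t^4\le X^2+Y^2}t^3\,dt\,dX\,dY=\frac14\operatorname{Im}L_2\Big(\frac{1+i\sqrt3}2\Big),$$ where $L_2(z)=\sum_{n=1}^\infty\frac{z^n}{n^2}$ is the dilogarithm.
   Context: The integral, denoted $\mathrm{vol}\,\widehat\Gamma_{\mathcal H}$ in the paper, is (up to the constant factor $2\pi^2$ coming from integration over $\mathrm{SU}(2)$) the volume for the invariant measure of $\mathrm{SL}_2(\mathbb C)$ of the set of shortest reduced bases over the Eisenstein integers, in Gram–Schmidt coordinates $\boldsymbol\alpha=(t,0)$, $\boldsymbol\beta=(t(X+iY),1/t)$. The set $\mathcal H$ is the regular hexagon of side $1/\sqrt3$ that is the Voronoi cell of the origin for the Eisenstein integers. *)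

(* Defs.v *)
From HB Require Import structures.
From mathcomp Require Import all_boot all_order all_algebra.
From mathcomp Require Import all_classical all_reals all_analysis.
From mathcomp Require Import complex.

Set Implicit Arguments.
Unset Strict Implicit.
Unset Printing Implicit Defensive.

Import Order.TTheory GRing.Theory Num.Theory.
Import numFieldNormedType.Exports.

Local Open Scope classical_set_scope.
Local Open Scope ring_scope.
Local Open Scope complex_scope.

Definition hexagon (R : realType) : set (R * R) :=
  [set p | `|p.1| <= 1 / 2 /\ Num.sqrt 3 * `|p.2| + `|p.1| <= 1].

(* The points are (t, (X, Y)). *)
Definition reduced_region (R : realType) : set (R * (R * R)) :=
  [set p | [/\ 0 < p.1, hexagon p.2 &
               1 - 1 / p.1 ^+ 4 <= p.2.1 ^+ 2 + p.2.2 ^+ 2]].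

(* The limit is taken in [R[i]^o], that is R[i] with the topology of its
   modulus; it is the sum of the series only where the series converges,
   i.e. for |z| <= 1. *)
Definition dilog (R : realType) (z : R[i]) : R[i] :=
  \big[+%R/0]_(1 <= n <oo) (z ^+ n / n%:R ^+ 2 : R[i]^o).

(* Main.v *)
Require Import Defs.
From HB Require Import structures.
From mathcomp Require Import all_boot all_order all_algebra.
From mathcomp Require Import all_classical all_reals all_analysis.
From mathcomp Require Import measurable_realfun complex ring lra.

(** Write [r^2 = X^2 + Y^2].  The hexagon lies in the open unit disk, so for a
    fixed point of it the condition on [t] reads [t^4 <= 1 / (1 - r^2)] and the
    [t]-integral is [1 / (4 (1 - r^2))] ([integral_cube_section]).  Over the
    abscissa [X] the hexagon is the segment [|Y| <= b] with
    [b = (1 - |X|) / sqrt 3], and with [a = sqrt (1 - X^2)] the [Y]-integral is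
    [(ln (a + b) - ln (a - b)) / (4 a)] ([integral_height]).

    The substitution [X = sin u], [0 <= u <= pi / 6], cancels the factor [a].
    The sum-to-product formulas give [a + b] and [a - b] a common factor, up to
    which they are [cos (u / 2 - pi / 12)] and [sin (u / 2 + pi / 12)].  Thus
    the right half of the hexagon contributes a quarter of the integral over
    [0 <= u <= pi / 6] of
    [ln (sin ((7 pi / 6 - u) / 2)) - ln (sin ((u + pi / 6) / 2))]
    ([hexagon_slice_sin]).

    On the open interval [0 < x < 2 pi], [- ln (sin (x / 2))] is, up to the
    additive constant [ln 2], the sum of the Fourier series [cos (n x) / n].
    The constant cancels in the difference above, so it is enough to compare
    the partial sums at two points: their defect has a derivative given by a
    Dirichlet kernel, hence is constant up to [O(1 / N)], uniformly away from
    the multiples of [2 pi] ([cos_sum_log_sin_close]).  Both points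
    [u + pi / 6] and [7 pi / 6 - u] stay between [pi / 6] and [7 pi / 6], so
    the integral is the limit of the integrals of the partial sums, whose
    primitives are the partial sums [S_N] of [sin (n x) / n^2]
    ([integral_uniform_limit]).  The duplication formula
    [S_2N (x) + S_2N (x + pi) = S_N (2 x) / 2] at [x = pi / 6] turns the
    boundary values into [S_2N (pi / 3) - S_N (pi / 3) / 2], which tends to
    half of the imaginary part of [L_2 (exp (i pi / 3))].  The two halves of
    the hexagon together give [2 * (1 / 4) * (1 / 2)] of it. *)

Set Implicit Arguments.
Unset Strict Implicit.
Unset Printing Implicit Defensive.

Import Order.TTheory GRing.Theory Num.Theory.
Import numFieldNormedType.Exports.

Local Open Scope classical_set_scope.
Local Open Scope ring_scope.
Local Open Scope complex_scope.

(** * Trigonometric partial sums and their logarithmic limit *)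

Definition cos_sum (R : realType) (N : nat) (x : R) : R :=
  \sum_(i < N) cos (i.+1%:R * x) / i.+1%:R.

Definition sin_sum (R : realType) (N : nat) (x : R) : R :=
  \sum_(i < N) sin (i.+1%:R * x) / i.+1%:R ^+ 2.

Lemma is_derive_scalel (R : realType) (f : R -> R) (c x df : R) :
  is_derive x 1 f df -> is_derive x 1 (fun y => c * f y) (c * df).
Proof. by move=> dfx; exact: (is_deriveZ (f := f) c). Qed.

Lemma is_derive_sum_fun (R : realType) (N : nat) (f : 'I_N -> R -> R)
    (df : 'I_N -> R) (x : R) :
  (forall i, is_derive x 1 (f i) (df i)) ->
  is_derive x 1 (fun y => \sum_(i < N) f i y) (\sum_(i < N) df i).
Proof.
move=> fdf; have -> : (fun y => \sum_(i < N) f i y) = \sum_(i < N) f i.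
  by apply/funext => y; rewrite fct_sumE.
exact: is_derive_sum.
Qed.

Lemma is_derive_mulc (R : realType) (c x : R) : is_derive x 1 ( *%R c) c.
Proof. by rewrite -[X in is_derive _ _ _ X]mulr1; exact: is_derive_scalel. Qed.

Lemma is_derive_cosM (R : realType) (c x : R) :
  is_derive x 1 (fun y : R => cos (c * y)) (- sin (c * x) * c).
Proof.
have -> : (fun y : R => cos (c * y)) = cos \o ( *%R c) by [].
apply: is_derive1_comp; exact: is_derive_mulc.
Qed.

Lemma is_derive_sinM (R : realType) (c x : R) :
  is_derive x 1 (fun y : R => sin (c * y)) (cos (c * x) * c).
Proof.
have -> : (fun y : R => sin (c * y)) = sin \o ( *%R c) by [].
apply: is_derive1_comp; exact: is_derive_mulc.
Qed.

Lemma is_derive_sin_sum (R : realType) (N : nat) (x : R) :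
  is_derive x 1 (sin_sum N) (cos_sum N x).
Proof.
apply: is_derive_sum_fun => i.
under eq_fun do rewrite mulrC.
rewrite (_ : _ / _ = i.+1%:R ^- 2 * (cos (i.+1%:R * x) * i.+1%:R)); last by field.
by apply: is_derive_scalel; exact: is_derive_sinM.
Qed.

Lemma is_derive_cos_sum (R : realType) (N : nat) (x : R) :
  is_derive x 1 (cos_sum N) (- \sum_(i < N) sin (i.+1%:R * x)).
Proof.
rewrite -sumrN; apply: is_derive_sum_fun => i.
under eq_fun do rewrite mulrC.
rewrite (_ : - _ = i.+1%:R ^-1 * (- sin (i.+1%:R * x) * i.+1%:R)); last by field.
by apply: is_derive_scalel; exact: is_derive_cosM.
Qed.

(** Each product [2 sin (x / 2) sin (k x)] is a difference of consecutive
    cosines at half-integer multiples of [x], so the sum telescopes. *)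
Lemma sum_sin_conj_dirichlet (R : realType) (N : nat) (x : R) :
  2 * sin (x / 2) * \sum_(i < N) sin (i.+1%:R * x) =
  cos (x / 2) - cos ((N%:R + 1 / 2) * x).
Proof.
elim: N => [|N IH].
  by rewrite big_ord0 mulr0 (_ : _ * x = x / 2) ?subrr//; field.
rewrite big_ord_recr/= mulrDr IH.
have -> : (N%:R + 1 / 2) * x = N.+1%:R * x - x / 2 by rewrite -natr1; field.
have -> : (N.+1%:R + 1 / 2) * x = N.+1%:R * x + x / 2 by field.
by rewrite cosB cosD; ring.
Qed.

(** Put [nu = N + 1 / 2].  By the Dirichlet kernel, the derivative of
    [cos_sum N z + ln (sin (z / 2))] is [cos (nu z) / (2 sin (z / 2))]: it does
    not decay, but it oscillates.  Subtracting the first term of an integration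
    by parts, [sin (nu z) / (2 nu sin (z / 2))], leaves a function [W] whose
    derivative is [O(1 / nu)], to which the mean value theorem applies.  Only
    a difference of two values is estimated, so the constant [ln 2] of the
    Fourier series never has to be identified. *)
Lemma cos_sum_log_sin_close (R : realType) (N : nat) (m x y : R) :
  0 < m -> x <= y -> (forall z, x <= z <= y -> m <= sin (z / 2)) ->
  `|(cos_sum N y + ln (sin (y / 2))) - (cos_sum N x + ln (sin (x / 2)))| <=
  ((y - x) / (4 * m ^+ 2) + 1 / m) / (N%:R + 1 / 2).
Proof.
move=> m0 xy msin; set nu := N%:R + 1 / 2.
have nu0 : 0 < nu by rewrite /nu; have := ler0n R N; lra.
have s0 z : x <= z <= y -> 0 < sin (z / 2) by move/msin; exact: lt_le_trans.
pose r z : R := (2 * nu)^-1 * (sin (nu * z) * (sin (z / 2))^-1).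
pose W z := cos_sum N z + (ln (sin (z / 2)) - r z).
pose dW z := sin (nu * z) * cos (z / 2) / (4 * nu * sin (z / 2) ^+ 2).
have dsin (z : R) : is_derive z 1 (fun t : R => sin (t / 2)) (cos (z / 2) / 2).
  rewrite mulrC; under eq_fun do rewrite mulrC.
  by rewrite mulrC [z / 2]mulrC; exact: is_derive_sinM.
have dWE (z : R) : x <= z <= y -> is_derive z 1 W (dW z).
  move=> /s0 sz0.
  have dln : is_derive z 1 (fun t : R => ln (sin (t / 2)))
      ((sin (z / 2))^-1 * (cos (z / 2) / 2)).
    apply: (@is_derive1_comp _ (@ln R) (fun t : R => sin (t / 2))).
    exact: is_derive1_ln.
  have dV : is_derive z 1 (fun t : R => (sin (t / 2))^-1)
      (- sin (z / 2) ^- 2 *: (cos (z / 2) / 2)).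
    by apply: (is_deriveV (f := fun t : R => sin (t / 2))); rewrite gt_eqF.
  have dM := is_deriveM (is_derive_sinM nu z) dV.
  have dr := is_derive_scalel (2 * nu)^-1 dM.
  have dall := is_deriveD (is_derive_cos_sum N z) (is_deriveB dln dr).
  apply: (is_derive_eq dall).
  have -> : \sum_(i < N) sin (i.+1%:R * z) =
      (cos (z / 2) - cos (nu * z)) / (2 * sin (z / 2)).
    by rewrite -sum_sin_conj_dirichlet mulrAC divff ?mul1r// mulf_neq0 ?gt_eqF.
  rewrite /dW /GRing.scale/=; field.
  by rewrite !gt_eqF.
have [c cxy Wyx] : exists2 c, c \in `[x, y] & W y - W x = dW c * (y - x).
  apply: MVT_segment => // [z zxy|].
    apply: dWE; move: zxy; rewrite in_itv/= => /andP[/ltW -> /ltW ->] //.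
  apply: derivable_within_continuous => z zxy.
  by apply: ex_derive; apply: dWE; move: zxy; rewrite in_itv.
have cxy' : x <= c <= y by move: cxy; rewrite in_itv.
have dWle : `|dW c| <= (4 * nu * m ^+ 2)^-1.
  rewrite /dW normrM -[leRHS]mul1r ler_pM//.
    by rewrite normrM mulr_ile1// ?sin_max ?cos_max.
  have sc0 := s0 _ cxy'.
  rewrite ger0_norm ?invr_ge0 ?mulr_ge0 ?(ltW nu0) ?(ltW sc0)//.
  rewrite lef_pV2 ?posrE ?mulr_gt0 ?exprn_gt0//.
  rewrite ler_pM2l ?mulr_gt0//.
  by apply: lerXn2r; rewrite ?msin// nnegrE ltW.
have rle z : x <= z <= y -> `|r z| <= (2 * nu)^-1 * m^-1.
  move=> zxy; have sz0 := s0 _ zxy.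
  rewrite /r !normrM ger0_norm ?invr_ge0 ?mulr_ge0 ?(ltW nu0)//.
  rewrite ler_pM2l ?invr_gt0 ?mulr_gt0// -[leRHS]mul1r ler_pM ?sin_max//.
  by rewrite ger0_norm ?invr_ge0 ?(ltW sz0)// lef_pV2 ?posrE// msin.
rewrite [X in `|X|](_ : _ = (W y - W x) + (r y - r x)); last by rewrite /W; ring.
apply: le_trans (ler_normD _ _) _.
have -> : ((y - x) / (4 * m ^+ 2) + 1 / m) / nu =
    (4 * nu * m ^+ 2)^-1 * (y - x) + ((2 * nu)^-1 * m^-1 + (2 * nu)^-1 * m^-1).
  by field; rewrite !gt_eqF.
apply: lerD.
  by rewrite Wyx normrM (ger0_norm (x := y - x)) ?subr_ge0// ler_wpM2r// subr_ge0.
by apply: le_trans (ler_normB _ _) _; rewrite lerD// rle ?lexx ?xy.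
Qed.

(** * The value at a third of pi, duplication and convergence *)

Lemma sin_natD_pi (R : realType) (n : nat) (x : R) :
  sin (n%:R * (x + pi)) = (-1) ^+ n * sin (n%:R * x).
Proof.
by rewrite mulrDr (mulr_natl pi) (alternatingn (@sinDpi R)).
Qed.

(** The odd terms at [x] and [x + pi] cancel, the even ones are equal. *)
Lemma sin_sum_duplication (R : realType) (N : nat) (x : R) :
  sin_sum N.*2 x + sin_sum N.*2 (x + pi) = sin_sum N (2 * x) / 2.
Proof.
rewrite /sin_sum -big_split/=.
under eq_bigr do rewrite sin_natD_pi.
elim: N => [|N IH]; first by rewrite !big_ord0 mul0r.
rewrite doubleS !big_ord_recr/= IH [RHS]mulrDl -[LHS]addrA; congr (_ + _).
rewrite -(signr_odd _ N.*2.+1) -(signr_odd _ N.*2.+2)/= odd_double/= expr0 expr1.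
rewrite -mul2n.
have -> : (2 * N).+2%:R * x = N.+1%:R * (2 * x).
  by rewrite -addn2 -(natr1 N) natrD natrM; ring.
have -> : (2 * N).+2%:R = 2 * N.+1%:R :> R by rewrite -natrM mulnS.
by field; rewrite -natrM !nat1r !pnatr_eq0.
Qed.

Lemma pi_third_bounds (R : realType) : 0 < (pi / 3 : R) < pi / 2.
Proof. by have := pi_gt0 R; lra. Qed.

(** The triple angle formula at [pi / 3] makes the cosine a root of
    [4 c^3 - 3 c + 1 = (c + 1) (2 c - 1)^2], and the cosine is positive. *)
Lemma cos_pi_third (R : realType) : cos (pi / 3) = 1 / 2 :> R.
Proof.
have /andP[h0 h1] := pi_third_bounds R.
set c := cos (pi / 3).
have c0 : 0 < c by apply: cos_gt0_pihalf; rewrite h1 andbT; have := pi_gt0 R; lra.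
have triple : (c + 1) * (2 * c - 1) ^+ 2 = 0.
  have := cospi R.
  rewrite (_ : pi = pi / 3 *+ 2 + pi / 3 :> R); last by rewrite mulr2n; field.
  rewrite cosD sin_mulr2n cos_mulr2n -/c => cos3.
  have s2 := sin2cos2 (pi / 3 : R); rewrite -/c in s2.
  set s := sin (pi / 3) in s2 cos3 *.
  move: cos3; set X := (X in X = _) => cos3.
  have -> : (c + 1) * (2 * c - 1) ^+ 2 = X + 1 + 2 * c * (s ^+ 2 - (1 - c ^+ 2)).
    by rewrite /X; ring.
  by rewrite cos3 s2; ring.
move/eqP: triple; rewrite mulf_eq0 expf_eq0/= => /orP[/eqP|/eqP]; lra.
Qed.

Lemma sin_pi_third (R : realType) : sin (pi / 3) = Num.sqrt 3 / 2 :> R.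
Proof.
have /andP[h0 h1] := pi_third_bounds R.
have s0 : 0 < sin (pi / 3 : R) by apply: sin_gt0_pi; have := pi_gt0 R; lra.
have q0 : 0 <= Num.sqrt 3 / 2 :> R by rewrite divr_ge0.
apply/eqP; rewrite -(@eqrXn2 _ 2 _ _ _ (ltW s0) q0)//.
by apply/eqP; rewrite sin2cos2 cos_pi_third [RHS]exprMn sqr_sqrtr// exprVn; field.
Qed.

Lemma is_cvg_sum_inv_sqr (R : realType) (c : nat -> R) :
  (forall n, `|c n| <= 1) ->
  cvgn (fun N => \sum_(i < N) c i / i.+1%:R ^+ 2).
Proof.
move=> c1.
have -> : (fun N => \sum_(i < N) c i / i.+1%:R ^+ 2) =
    series (fun i => c i / i.+1%:R ^+ 2).
  by apply/funext => N; rewrite /series/= big_mkord.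
apply: normed_cvg.
apply: (@series_le_cvg _ _ (fun i => i.+1%:R ^- 2)) => [n|n|n|] //=.
- rewrite normrM -[leRHS]mul1r; apply: ler_pM => //.
  by rewrite ger0_norm.
pose s : R^nat := series (fun i => i.+1%:R ^- 2).
(* Telescoping: [1 / (N + 2)^2] is less than [1 / (N + 1) - 1 / (N + 2)]. *)
have sle N : s N.+1 <= 2 - N.+1%:R^-1.
  elim: N => [|N IH]; first by rewrite /s seriesSr/= /series/= big_nil; lra.
  rewrite /s seriesSr; apply: (le_trans (lerD IH (lexx _))).
  rewrite -subr_ge0 -[N.+2%:R]natr1; set t := N.+1%:R.
  have t0 : 0 < t by rewrite ltr0n.
  rewrite [leRHS](_ : _ = (t * (t + 1) ^+ 2)^-1); last by field; lra.
  by rewrite invr_ge0 mulr_ge0 ?sqr_ge0 ?ltW.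
apply: nondecreasing_is_cvgn.
  by apply/nondecreasing_seqP => n; rewrite /= seriesSr lerDl.
exists 2 => _ [[|N] _ <-]; first by rewrite /series/= big_nil.
by apply: le_trans (sle N) _; rewrite gerBl.
Qed.

(** * The imaginary part of the dilogarithm on the unit circle *)

(** Convergence of both parts suffices for convergence in modulus. *)
Lemma cvg_complex (R : realType) (u v : nat -> R) (a b : R) :
  u n @[n --> \oo] --> a -> v n @[n --> \oo] --> b ->
  (fun n => u n +i* v n : R[i]^o) n @[n --> \oo] --> (a +i* b : R[i]^o).
Proof.
move=> ua vb; apply/cvgrPdist_le => /= e e0.
have [e' ee'] : exists e' : R, e = e'%:C by apply/complex_realP; rewrite gtr0_real.
have e'0 : 0 < e' / 2 by move: e0; rewrite ee' ltcR; lra.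
near=> n.
have ue : `|a - u n| <= e' / 2 by near: n; move/cvgrPdist_le : ua; exact.
have ve : `|b - v n| <= e' / 2 by near: n; move/cvgrPdist_le : vb; exact.
have -> : (a +i* b) - (u n +i* v n) = (a - u n)%:C + 'i * (b - v n)%:C.
  by rewrite [LHS]complexE.
apply: le_trans (ler_normD _ _) _.
rewrite normrM !normc_def/= !expr0n/= !addr0 !add0r expr1n sqrtr1 mul1r !sqrtr_sqr.
by rewrite -rmorphD/= ee' lecR; lra.
Unshelve. all: by end_near. Qed.

Lemma moivre (R : realType) (x : R) (n : nat) :
  (cos x +i* sin x) ^+ n = cos (n%:R * x) +i* sin (n%:R * x).
Proof.
elim: n => [|n IH]; first by rewrite mul0r cos0 sin0.
rewrite exprS IH -nat1r mulrDl mul1r cosD sinD.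
by apply/eqP; rewrite eq_complex/=; apply/andP; split; apply/eqP; ring.
Qed.

Lemma complex_sum (R : realType) (N : nat) (a b : 'I_N -> R) :
  \sum_(i < N) (a i +i* b i) = (\sum_(i < N) a i) +i* (\sum_(i < N) b i).
Proof. by elim/big_rec3 : _ => //= i x y _ _ ->. Qed.

(** The dilogarithm is a limit of complex partial sums, and a limit is only
    meaningful once convergence is known: the real and imaginary parts are
    compared with the sum of [1 / n^2], then recombined. *)
Lemma sin_sum_cvg_dilog (R : realType) (x : R) :
  sin_sum N x @[N --> \oo] --> complex.Im (dilog (cos x +i* sin x)).
Proof.
pose s N := \sum_(i < N) sin (i.+1%:R * x) / i.+1%:R ^+ 2.
pose c N := \sum_(i < N) cos (i.+1%:R * x) / i.+1%:R ^+ 2.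
have /is_cvg_sum_inv_sqr cs : forall n, `|sin (n.+1%:R * x)| <= 1.
  by move=> n; exact: sin_max.
have /is_cvg_sum_inv_sqr cc : forall n, `|cos (n.+1%:R * x)| <= 1.
  by move=> n; exact: cos_max.
suff -> : dilog (cos x +i* sin x) = limn c +i* limn s by [].
rewrite /dilog; apply: (@cvg_lim (R[i]^o)); first exact: norm_hausdorff.
rewrite -cvg_shiftS/=.
have -> : (fun n => \sum_(1 <= i < n.+1) ((cos x +i* sin x) ^+ i / i%:R ^+ 2)) =
   (fun n => c n +i* s n).
  apply/funext => n; rewrite big_add1/= big_mkord -complex_sum.
  apply: eq_bigr => i _; rewrite moivre.
  have -> : i.+1%:R ^+ 2 = (i.+1%:R ^+ 2)%:C :> R[i] by rewrite rmorphXn rmorph_nat.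
  rewrite -fmorphV.
  by apply/eqP; rewrite eq_complex/= !mulr0 subr0 add0r !eqxx.
exact: cvg_complex.
Qed.

Lemma sixth_root_of_unity (R : realType) :
  (1 +i* Num.sqrt (3 : R)) / 2 = cos (pi / 3) +i* sin (pi / 3).
Proof.
rewrite cos_pi_third sin_pi_third.
have -> : 2 = 2%:C :> R[i] by rewrite rmorph_nat.
rewrite -fmorphV.
by apply/eqP; rewrite eq_complex/= !mulr0 subr0 add0r !eqxx.
Qed.

(** * Integrals of uniform limits of derivatives *)

Lemma integral_is_derive (R : realType) (a b : R) (F f : R -> R) :
  a < b -> {within `[a, b], continuous f} ->
  (forall x, a <= x <= b -> is_derive x 1 F (f x)) ->
  (\int[lebesgue_measure]_(x in `[a, b]) (f x)%:E)%E = (F b - F a)%:E.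
Proof.
move=> ab cf dF; rewrite EFinB; apply: continuous_FTC2 => //.
  have cF x : a <= x <= b -> {for x, continuous F}.
    move=> /dF dFx; apply/differentiable_continuous/derivable1_diffP.
    exact: ex_derive.
  split.
  - move=> x; rewrite in_itv/= => /andP[/ltW ax /ltW xb].
    by apply: ex_derive; apply: dF; rewrite ax.
  - by apply: cvg_at_right_filter; apply: cF; rewrite lexx ltW.
  - by apply: cvg_at_left_filter; apply: cF; rewrite lexx ltW.
move=> x; rewrite in_itv/= => /andP[/ltW ax /ltW xb].
by rewrite derive1E; apply: derive_val; apply: dF; rewrite ax.
Qed.

(** The fundamental theorem of calculus applies to [F n x + c * x] with
    [c] equal to [e n] or [- e n]; these integrals enclose that of [k]. *)
Lemma integral_uniform_limit (R : realType) (a b l : R) (k : R -> R)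
    (F f : nat -> R -> R) (e : nat -> R) :
  a < b -> {within `[a, b], continuous k} ->
  (forall n, {within `[a, b], continuous f n}) ->
  (forall n x, a <= x <= b -> is_derive x 1 (F n) (f n x)) ->
  (forall n x, a <= x <= b -> `|f n x - k x| <= e n) ->
  e n @[n --> \oo] --> 0 ->
  F n b - F n a @[n --> \oo] --> l ->
  (\int[lebesgue_measure]_(x in `[a, b]) (k x)%:E)%E = l%:E.
Proof.
move=> ab ck cf dF fk e0 Fl.
have integrable_cont (g : R -> R) : {within `[a, b], continuous g} ->
    (@lebesgue_measure R).-integrable `[a, b] (EFin \o g).
  by move=> cg; apply: continuous_compact_integrable => //; exact: segment_compact.
have cfe n c : {within `[a, b], continuous (fun x => f n x + c)}.
  by move=> x; apply: cvgD; [exact: cf|exact: cvg_cst].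
have intfe n c : (\int[lebesgue_measure]_(x in `[a, b]) (f n x + c)%:E)%E =
    (F n b - F n a + c * (b - a))%:E.
  have dFc x : a <= x <= b -> is_derive x 1 (fun x => F n x + c * x) (f n x + c).
    by move=> /(dF n) dFx; apply: is_deriveD; exact: is_derive_mulc.
  by rewrite (integral_is_derive ab (cfe n c) dFc); congr EFin; ring.
set I := (X in X = _).
have Ifin : I \is a fin_num by apply: integrable_fin_num => //; exact: integrable_cont.
have Ile n : `|(F n b - F n a) - fine I| <= e n * (b - a).
  have up : (I <= (F n b - F n a + e n * (b - a))%:E)%E.
    rewrite -intfe; apply: le_integral => //; do ?exact: integrable_cont.
    move=> x; rewrite inE/= in_itv/= lee_fin => /(fk n).
    by rewrite ler_norml => /andP[? ?]; lra.
  have lo : ((F n b - F n a + - e n * (b - a))%:E <= I)%E.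
    rewrite -intfe; apply: le_integral => //; do ?exact: integrable_cont.
    move=> x; rewrite inE/= in_itv/= lee_fin => /(fk n).
    by rewrite ler_norml => /andP[? ?]; lra.
  move: up lo; rewrite -(fineK Ifin) !lee_fin ler_norml => up lo.
  by apply/andP; split; lra.
rewrite -(fineK Ifin); congr EFin.
suff : F n b - F n a @[n --> \oo] --> fine I.
  by move=> FI; apply: (cvg_unique _ FI Fl); exact: norm_hausdorff.
apply/subr_cvg0.
apply/norm_cvg0P.
apply: (@squeeze_cvgr _ _ _ _ (fun=> 0) (fun n => e n * (b - a))).
- by apply: nearW => n; rewrite normr_ge0 Ile.
- exact: cvg_cst.
- by rewrite -[X in _ --> X](mul0r (b - a)); apply: cvgMr_tmp.
Qed.

(** * The integral of the logarithmic sine ratio *)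

Lemma is_derive_reflect (R : realType) (f : R -> R) (c x df : R) :
  is_derive (c - x) 1 f df -> is_derive x 1 (fun y => f (c - y)) (- df).
Proof.
move=> dfx; rewrite -mulrN1; apply: (@is_derive1_comp _ f (fun y => c - y)).
rewrite -[X in is_derive _ _ _ X]sub0r; apply: is_deriveB; exact: is_derive_id.
Qed.

Lemma is_derive_translate (R : realType) (f : R -> R) (c x df : R) :
  is_derive (x + c) 1 f df -> is_derive x 1 (fun y => f (y + c)) df.
Proof.
move=> dfx; rewrite -[X in is_derive _ _ _ X]mulr1.
apply: (@is_derive1_comp _ f (fun y => y + c)).
rewrite -[X in is_derive _ _ _ X]addr0; apply: is_deriveD; exact: is_derive_id.
Qed.

(** The half angle stays within [5 pi / 12] of [pi / 2]. *)
Lemma sin_half_lower_bound (R : realType) (z : R) :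
  pi / 6 <= z <= 7 / 6 * pi -> cos (5 / 12 * pi) <= sin (z / 2).
Proof.
move=> /andP[z1 z2]; have p0 := pi_gt0 R.
rewrite -cosBpihalf -[cos (z / 2 - _)]cos_norm.
have zn : `|z / 2 - pi / 2| <= 5 / 12 * pi by rewrite ler_norml; lra.
rewrite leNgt ltr_cos -?leNgt//; rewrite in_itv/= ?normr_ge0/=; lra.
Qed.

Definition log_sin_ratio (R : realType) (u : R) : R :=
  ln (sin ((7 / 6 * pi - u) / 2)) - ln (sin ((u + pi / 6) / 2)).

Lemma continuous_log_sin_ratio (R : realType) :
  {within `[0, pi / 6], continuous (@log_sin_ratio R)}.
Proof.
have p0 := pi_gt0 R.
have c0 : 0 < cos (5 / 12 * pi) :> R by apply: cos_gt0_pihalf; lra.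
apply: derivable_within_continuous => u; rewrite in_itv/= => /andP[u0 u1].
have dl (z : R) : pi / 6 <= z <= 7 / 6 * pi ->
    is_derive z 1 (fun t : R => ln (sin (t / 2)))
      ((sin (z / 2))^-1 * (cos (z / 2) / 2)).
  move=> /sin_half_lower_bound /(lt_le_trans c0) sz.
  apply: (@is_derive1_comp _ (@ln R) (fun t : R => sin (t / 2))).
    exact: is_derive1_ln.
  rewrite mulrC [z / 2]mulrC; under eq_fun do rewrite mulrC.
  by rewrite mulrC; exact: is_derive_sinM.
apply: ex_derive; apply: is_deriveB.
  by apply: (is_derive_reflect (f := fun t => ln (sin (t / 2)))); apply: dl; lra.
by apply: (is_derive_translate (f := fun t => ln (sin (t / 2)))); apply: dl; lra.
Qed.

(** Both arguments of [cos_sum] stay where [sin (z / 2)] is bounded below, so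
    the partial sums approximate the integrand uniformly.  Partial sums of even
    length are used in order to apply the duplication formula exactly. *)
Lemma integral_log_sin_ratio (R : realType) :
  (\int[lebesgue_measure]_(u in `[0%R, (pi / 6)%R]) (@log_sin_ratio R u)%:E)%E =
  (complex.Im (dilog (cos (pi / 3 : R) +i* sin (pi / 3))) / 2)%:E.
Proof.
have p0 := pi_gt0 R.
set m : R := cos (5 / 12 * pi).
have m0 : 0 < m by apply: cos_gt0_pihalf; lra.
pose F (N : nat) (u : R) := sin_sum N.*2 (u + pi / 6) + sin_sum N.*2 (7 / 6 * pi - u).
pose f (N : nat) (u : R) := cos_sum N.*2 (u + pi / 6) - cos_sum N.*2 (7 / 6 * pi - u).
pose e (N : nat) : R := (pi / (4 * m ^+ 2) + 1 / m) / (N.*2%:R + 1 / 2).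
apply: (integral_uniform_limit (F := F) (f := f) (e := e)).
- lra.
- exact: continuous_log_sin_ratio.
- move=> n; apply: derivable_within_continuous => u _; apply: ex_derive.
  apply: is_deriveB.
    by apply: is_derive_translate; exact: is_derive_cos_sum.
  by apply: is_derive_reflect; exact: is_derive_cos_sum.
- move=> n u _; apply: is_deriveD.
    by apply: is_derive_translate; exact: is_derive_sin_sum.
  by apply: is_derive_reflect; exact: is_derive_sin_sum.
- move=> N u /andP[u0 u1]; rewrite /f /log_sin_ratio.
  set x := u + pi / 6; set y := 7 / 6 * pi - u.
  have xy : x <= y by rewrite /x /y; lra.
  have close : `|(cos_sum N.*2 y + ln (sin (y / 2))) -
      (cos_sum N.*2 x + ln (sin (x / 2)))| <=
      ((y - x) / (4 * m ^+ 2) + 1 / m) / (N.*2%:R + 1 / 2).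
    apply: cos_sum_log_sin_close => // z zxy; apply: sin_half_lower_bound.
    by move: zxy; rewrite /x /y; lra.
  rewrite -normrN; move: close; rewrite [X in `|X| <= _](_ : _ =
    - (cos_sum N.*2 x - cos_sum N.*2 y - (ln (sin (y / 2)) - ln (sin (x / 2)))));
    last by ring.
  move=> /le_trans; apply; rewrite /e ler_pM2r ?invr_gt0; last first.
    by have := ler0n R N.*2; lra.
  rewrite lerD2r ler_pM2r ?invr_gt0 ?mulr_gt0 ?exprn_gt0//.
  by rewrite /x /y; lra.
- rewrite /e -[X in _ --> X](mulr0 (pi / (4 * m ^+ 2) + 1 / m)).
  apply: cvgMl_tmp.
  apply: (@squeeze_cvgr _ _ _ _ (fun=> 0) (fun N => 2 * N.+1%:R^-1)).
  + apply: nearW => N; have N0 := ler0n R N.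
    have d0 : 0 < N.*2%:R + 1 / 2 :> R by rewrite -mul2n natrM; lra.
    rewrite invr_ge0 ltW//= ler_pdivlMr ?ltr0n// mulrC ler_pdivrMr//.
    by rewrite -mul2n natrM -natr1; lra.
  + exact: cvg_cst.
  + rewrite -[X in _ --> X](mulr0 (2 : R)); apply: cvgMl_tmp.
    exact: cvg_harmonic.
have S := @sin_sum_cvg_dilog R (pi / 3).
set l := complex.Im _ in S *.
have FE N : F N (pi / 6) - F N 0 = sin_sum N.*2 (pi / 3) - sin_sum N (pi / 3) / 2.
  have -> : pi / 3 = 2 * (pi / 6) :> R by field.
  rewrite -sin_sum_duplication /F.
  have -> : pi / 6 + pi / 6 = 2 * (pi / 6) :> R by field.
  have -> : 0 + pi / 6 = pi / 6 :> R by rewrite add0r.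
  have -> : 7 / 6 * pi - 0 = pi / 6 + pi :> R by field.
  have -> : 7 / 6 * pi - pi / 6 = pi :> R by field.
  have -> : sin_sum N.*2 pi = 0 :> R.
    rewrite /sin_sum big1// => i _.
    by rewrite -{1}[pi]add0r sin_natD_pi mulr0 sin0 mulr0 mul0r.
  by ring.
under eq_fun do rewrite FE.
have -> : l / 2 = l - l / 2 by field.
apply: cvgB.
  apply: (@cvg_comp _ _ _ double (fun N => sin_sum N (pi / 3)) _ _ _ _ S).
  move=> A [N _ NA]; exists N => // n /= Nn; apply: NA => /=.
  by rewrite -addnn (leq_trans Nn)// leq_addr.
by apply: cvgMr_tmp.
Qed.

(** * The integral over the abscissa of the hexagon *)

(** Half the length of the chord of the unit disk at abscissa [X]. *)
Definition half_chord (R : realType) (X : R) : R := Num.sqrt (1 - X ^+ 2).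

(** Half the length of the chord of the hexagon at abscissa [X]. *)
Definition half_height (R : realType) (X : R) : R := (1 - `|X|) / Num.sqrt 3.

(** The value found below for the integral of [1 / (4 (1 - X^2 - Y^2))] along
    the chord of the hexagon at abscissa [X]. *)
Definition hexagon_slice (R : realType) (X : R) : R :=
  (ln (half_chord X + half_height X) - ln (half_chord X - half_height X))
  / (4 * half_chord X).

Lemma half_chord_gt0 (R : realType) (X : R) : `|X| <= 1 / 2 -> 0 < half_chord X.
Proof.
move=> X2; rewrite sqrtr_gt0 subr_gt0 -real_normK ?num_real//.
by have := normr_ge0 X; nra.
Qed.

Lemma half_height_ge0 (R : realType) (X : R) : `|X| <= 1 / 2 -> 0 <= half_height X.
Proof. by move=> X2; rewrite divr_ge0// ?sqrtr_ge0//; lra. Qed.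

Lemma half_height_lt_chord (R : realType) (X : R) :
  `|X| <= 1 / 2 -> half_height X < half_chord X.
Proof.
move=> X2; have a0 := half_chord_gt0 X2; have b0 := half_height_ge0 X2.
rewrite -(@ltr_pXn2r _ 2) ?nnegrE ?(ltW a0)// /half_height /half_chord.
rewrite exprMn exprVn !sqr_sqrtr//; last first.
  by rewrite subr_ge0 -real_normK ?num_real//; have := normr_ge0 X; nra.
by rewrite -[X in _ < 1 - X]real_normK ?num_real//; have := normr_ge0 X; nra.
Qed.

Lemma continuous_hexagon_slice (R : realType) :
  {within `[- (1 / 2), 1 / 2], continuous (@hexagon_slice R)}.
Proof.
apply: continuous_in_subspaceT => x; rewrite inE/= in_itv/= -ler_norml => x2.
have a0 := half_chord_gt0 x2; have b0 := half_height_ge0 x2.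
have ba := half_height_lt_chord x2.
have ca : half_chord X @[X --> x] --> half_chord x.
  apply: (@continuous_comp _ _ _ (fun X : R => 1 - X ^+ 2) Num.sqrt).
    by apply: cvgB; [exact: cvg_cst|exact: exprn_continuous].
  exact: sqrt_continuous.
have cb : half_height X @[X --> x] --> half_height x.
  apply: cvgMr_tmp; apply: cvgB; first exact: cvg_cst.
  exact: norm_continuous.
apply: cvgM; last first.
  apply: cvgV; first by rewrite mulf_neq0// gt_eqF.
  exact: cvgMl_tmp.
apply: cvgB.
  apply: (@cvg_comp _ _ _ (fun X => half_chord X + half_height X) (@ln R)).
    exact: cvgD ca cb.
  by apply: continuous_ln; lra.
apply: (@cvg_comp _ _ _ (fun X => half_chord X - half_height X) (@ln R)).
  exact: cvgB ca cb.
by apply: continuous_ln; lra.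
Qed.

Lemma cos_mul_cos (R : realType) (x y : R) :
  2 * (cos x * cos y) = cos (x + y) + cos (x - y).
Proof. by rewrite cosD cosB; ring. Qed.

Lemma cos_mul_sin (R : realType) (x y : R) :
  2 * (cos x * sin y) = sin (x + y) - sin (x - y).
Proof. by rewrite sinD sinB; ring. Qed.

Lemma cos_pi_sixth (R : realType) : cos (pi / 6) = Num.sqrt 3 / 2 :> R.
Proof.
by rewrite -sin_pi_third -cosBpihalf -[LHS]cosN; congr cos; field.
Qed.

Lemma sin_pi_sixth (R : realType) : sin (pi / 6) = 1 / 2 :> R.
Proof.
by rewrite -cos_pi_third -[RHS]opprK -sinBpihalf -sinN; congr sin; field.
Qed.

(** With [X = sin u] one has [a = cos u].  Since
    [sqrt 3 cos u - sin u = 2 cos (u + pi / 6)], [a + b] is proportional to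
    [cos (u + pi / 6) + cos (pi / 3)]; likewise [a - b] is proportional to
    [sin (u + pi / 3) - sin (pi / 6)].  As products both contain the factor
    [cos (u / 2 + pi / 4)], which disappears from the difference of the
    logarithms. *)
Lemma hexagon_slice_sin (R : realType) (u : R) :
  0 <= u <= pi / 6 -> hexagon_slice (sin u) * cos u = log_sin_ratio u / 4.
Proof.
move=> /andP[u0 u1]; have p0 := pi_gt0 R.
have cu : 0 < cos u by apply: cos_gt0_pihalf; lra.
have su : 0 <= sin u by apply: sin_ge0_pi; lra.
have chordE : half_chord (sin u) = cos u.
  by rewrite /half_chord -cos2sin2 sqrtr_sqr ger0_norm// ltW.
rewrite /hexagon_slice chordE /half_height (ger0_norm su) /log_sin_ratio.
have q0 : 0 < Num.sqrt 3 :> R by rewrite sqrtr_gt0.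
set s3 := Num.sqrt 3 in q0 *.
have s3K : s3 * s3 = 3 by rewrite -expr2 sqr_sqrtr.
have c3 : 0 < cos (u / 2 + pi / 4) by apply: cos_gt0_pihalf; lra.
have c1 : 0 < cos (u / 2 - pi / 12) by apply: cos_gt0_pihalf; lra.
have s1 : 0 < sin (u / 2 + pi / 12) by apply: sin_gt0_pi; lra.
have plusE : cos u + (1 - sin u) / s3 =
    4 / s3 * cos (u / 2 + pi / 4) * cos (u / 2 - pi / 12).
  have prod : 2 * (cos (u / 2 + pi / 4) * cos (u / 2 - pi / 12)) =
      cos (u + pi / 6) + cos (pi / 3).
    have -> : u + pi / 6 = (u / 2 + pi / 4) + (u / 2 - pi / 12) by field.
    have -> : pi / 3 = (u / 2 + pi / 4) - (u / 2 - pi / 12) by field.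
    exact: cos_mul_cos.
  rewrite [in RHS]cosD cos_pi_sixth sin_pi_sixth cos_pi_third -/s3 in prod.
  have -> : 4 / s3 * cos (u / 2 + pi / 4) * cos (u / 2 - pi / 12) = 2 / s3 *
    (2 * (cos (u / 2 + pi / 4) * cos (u / 2 - pi / 12))) by ring.
  by rewrite prod; field; rewrite gt_eqF.
have minusE : cos u - (1 - sin u) / s3 =
    4 / s3 * cos (u / 2 + pi / 4) * sin (u / 2 + pi / 12).
  have prod : 2 * (cos (u / 2 + pi / 4) * sin (u / 2 + pi / 12)) =
      sin (u + pi / 3) - sin (pi / 6).
    have -> : u + pi / 3 = (u / 2 + pi / 4) + (u / 2 + pi / 12) by field.
    have -> : pi / 6 = (u / 2 + pi / 4) - (u / 2 + pi / 12) by field.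
    exact: cos_mul_sin.
  rewrite [in RHS]sinD sin_pi_sixth sin_pi_third cos_pi_third -/s3 in prod.
  have -> : 4 / s3 * cos (u / 2 + pi / 4) * sin (u / 2 + pi / 12) = 2 / s3 *
    (2 * (cos (u / 2 + pi / 4) * sin (u / 2 + pi / 12))) by ring.
  by rewrite prod; field; rewrite gt_eqF.
have f0 : 0 < 4 / s3 * cos (u / 2 + pi / 4) by rewrite mulr_gt0// divr_gt0.
rewrite plusE minusE [ln (_ * cos _)]lnM ?posrE// [ln (_ * sin _)]lnM ?posrE//.
have -> : sin ((7 / 6 * pi - u) / 2) = cos (u / 2 - pi / 12).
  by rewrite -cosBpihalf -cosN; congr cos; field.
have -> : (u + pi / 6) / 2 = u / 2 + pi / 12 by field.
by field; rewrite gt_eqF.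
Qed.

Lemma integral_hexagon_slice_pos (R : realType) :
  (\int[lebesgue_measure]_(X in `[0%R, (1 / 2)%R]) (@hexagon_slice R X)%:E)%E =
  (complex.Im (dilog (cos (pi / 3 : R) +i* sin (pi / 3))) / 8)%:E.
Proof.
have p0 := pi_gt0 R.
have sin'E : derive1 (@sin R) = cos.
  by apply/funext => x; rewrite derive1E; exact: derive_val.
rewrite -[0 in X in integral _ X _](@sin0 R) -(@sin_pi_sixth R).
rewrite integration_by_substitution_increasing.
- transitivity (\int[lebesgue_measure]_(u in `[0%R, (pi / 6)%R])
      ((4^-1)%:E * (@log_sin_ratio R u)%:E))%E.
    apply: eq_integral => u; rewrite inE/= in_itv/= => u01.
    by rewrite -EFinM sin'E; congr EFin; rewrite [LHS]hexagon_slice_sin// mulrC.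
  rewrite integralZl//; last first.
    apply: continuous_compact_integrable; first exact: segment_compact.
    exact: continuous_log_sin_ratio.
  by rewrite integral_log_sin_ratio -EFinM; congr EFin; field.
- lra.
- move=> x y; rewrite !in_itv/= => /andP[x0 x1] /andP[y0 y1] xy.
  by rewrite ltr_sin// in_itv/=; apply/andP; split; lra.
- by move=> x _; rewrite sin'E; exact: continuous_cos.
- rewrite sin'E; apply/cvg_ex; exists (cos 0).
  by apply: cvg_at_right_filter; exact: continuous_cos.
- rewrite sin'E; apply/cvg_ex; exists (cos (pi / 6)).
  by apply: cvg_at_left_filter; exact: continuous_cos.
- split=> [x _||].
  + exact: derivable_sin.
  + by apply: cvg_at_right_filter; exact: continuous_sin.
  + by apply: cvg_at_left_filter; exact: continuous_sin.
- rewrite sin0 sin_pi_sixth; apply: continuous_subspaceW (@continuous_hexagon_slice R).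
  by apply: subset_itvr; rewrite bnd_simp; lra.
Qed.

Lemma hexagon_sliceN (R : realType) (X : R) : hexagon_slice (- X) = hexagon_slice X.
Proof. by rewrite /hexagon_slice /half_chord /half_height sqrrN normrN. Qed.

Lemma integral_hexagon_slice (R : realType) :
  (\int[lebesgue_measure]_(X in `[(- (1 / 2))%R, (1 / 2)%R])
     (@hexagon_slice R X)%:E)%E =
  (1 / 4 * complex.Im (dilog (cos (pi / 3 : R) +i* sin (pi / 3))))%:E.
Proof.
have mk : measurable_fun (`[- (1 / 2), 1 / 2]%classic : set R) (@hexagon_slice R).
  apply: subspace_continuous_measurable_fun => //.
  exact: continuous_hexagon_slice.
have h1 : - (1 / 2) <= 0 :> R by lra.
have h2 : 0 <= 1 / 2 :> R by lra.
(* The slice is even in [X], so the negative half equals the positive one. *)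
rewrite (@itv_bndbnd_setU _ _ _ (BRight (0 : R))) ?bnd_simp//.
rewrite integral_setU//=.
- rewrite integral_itv_obnd_cbnd; last first.
    apply/measurable_EFinP; apply: measurable_funS mk => //.
    by apply: subset_itvr; rewrite bnd_simp.
  have := @integration_by_substitution_oppr R (@hexagon_slice R) 0 (1 / 2) h2.
  rewrite oppr0 => ->; last first.
    apply: continuous_subspaceW (@continuous_hexagon_slice R).
    by apply: subset_itvl; rewrite bnd_simp.
  under eq_integral do rewrite /= hexagon_sliceN.
  by rewrite integral_hexagon_slice_pos -EFinD; congr EFin; field.
- rewrite -itv_bndbnd_setU ?bnd_simp//.
  exact/measurable_EFinP.
- apply/disj_set2P; rewrite -subset0 => x/=; rewrite !in_itv/=; lra.
Qed.

(** * Tonelli and the inner integrals *)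

(** Tonelli's theorem for a triple product treats one factor as a product,
    which therefore has to be sigma-finite. *)
Lemma sigma_finite_product d1 d2 (T1 : measurableType d1)
    (T2 : measurableType d2) (R : realType)
    (m1 : {sigma_finite_measure set T1 -> \bar R})
    (m2 : {sigma_finite_measure set T2 -> \bar R}) :
  sigma_finite [set: T1 * T2] (m1 \x m2)%E.
Proof.
have /sigma_finiteP[A [AT Aincr Afin]] := sigma_finiteT m1.
have /sigma_finiteP[B [BT Bincr Bfin]] := sigma_finiteT m2.
exists (fun n => A n `*` B n) => [|n].
  apply/esym; rewrite -subTset => -[x y] _.
  have [i _ Aix] : (\bigcup_i A i) x by rewrite -AT.
  have [j _ Bjy] : (\bigcup_j B j) y by rewrite -BT.
  exists (maxn i j) => //; split.
    by have /subsetPset := Aincr _ _ (leq_maxl i j); apply.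
  by have /subsetPset := Bincr _ _ (leq_maxr i j); apply.
have [mA Aoo] := Afin n; have [mB Boo] := Bfin n.
split; first exact: measurableX.
by rewrite product_measure1E// lte_mul_pinfty// ge0_fin_numE.
Qed.

(** Two applications of Tonelli's theorem, the function being extended by
    zero outside [D].  The innermost integral is over the first coordinate,
    which for the region at hand has intervals as sections. *)
Lemma integral_triple_sections d1 d2 d3 (T1 : measurableType d1)
    (T2 : measurableType d2) (T3 : measurableType d3) (R : realType)
    (m1 : {sigma_finite_measure set T1 -> \bar R})
    (m2 : {sigma_finite_measure set T2 -> \bar R})
    (m3 : {sigma_finite_measure set T3 -> \bar R})
    (D : set (T1 * (T2 * T3))) (f : T1 * (T2 * T3) -> \bar R) :
  measurable D -> measurable_fun D f -> (forall p, D p -> (0 <= f p)%E) ->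
  (\int[m1 \x (m2 \x m3)]_(p in D) f p =
   \int[m2]_y \int[m3]_z \int[m1]_(x in [set x | D (x, (y, z))]) f (x, (y, z)))%E.
Proof.
move=> mD mf f0; pose g := f \_ D.
have mg : measurable_fun setT g by exact: (proj1 (measurable_restrictT f mD) mf).
have g0 p : (0 <= g p)%E.
  by rewrite /g patchE; case: ifPn => //; rewrite inE => /f0.
pose m23 := HB.pack_for {sigma_finite_measure set (T2 * T3)%type -> \bar R}
  (m2 \x m3)%E (Measure_isSigmaFinite.Build _ _ _ _ (sigma_finite_product m2 m3)).
transitivity (\int[m1 \x m23]_(p in D) f p)%E; first by [].
rewrite integral_mkcond -/g (fubini_tonelli2 g mg g0).
transitivity (\int[m2 \x m3]_q fubini_G m1 g q)%E; first by [].
rewrite (fubini_tonelli1 (m1 := m2) (m2 := m3)).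
- apply: eq_integral => y _; apply: eq_integral => z _.
  rewrite /fubini_G [RHS]integral_mkcond; apply: eq_integral => x _.
  rewrite /g !patchE.
  by have [h|h] := boolP ((x, (y, z)) \in D); [rewrite ifT|rewrite ifN].
- exact: measurable_fun_fubini_tonelli_G.
- by move=> q; apply: integral_ge0.
Qed.

Lemma measurable_bool_set d (T : measurableType d) (b : T -> bool) :
  measurable_fun setT b -> measurable [set x | b x].
Proof. by move=> mb; rewrite -[X in measurable X]setTI; exact: (mb measurableT [set true]). Qed.

(** For [t > 0] the last condition can be multiplied by [t^4]; the result is
    polynomial in the coordinates, so its measurability is immediate. *)
Lemma reduced_region_boolE (R : realType) :
  @reduced_region R = [set p | [&& 0 < p.1, `|p.2.1| <= 1 / 2,
     Num.sqrt 3 * `|p.2.2| + `|p.2.1| <= 1 &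
     (1 - (p.2.1 ^+ 2 + p.2.2 ^+ 2)) * p.1 ^+ 4 <= 1]].
Proof.
have E (t s : R) : 0 < t -> (1 - 1 / t ^+ 4 <= s) = ((1 - s) * t ^+ 4 <= 1).
  by move=> t0; rewrite lerBlDr -lerBlDl ler_pdivlMr// exprn_gt0.
apply/seteqP; split => -[t [X Y]]/=.
  by move=> [/= t0 [-> ->]]; rewrite E// t0 => ->.
by move=> /and4P[t0 X2 Y2 h]; split; rewrite //= E.
Qed.

Lemma measurable_reduced_region (R : realType) : measurable (@reduced_region R).
Proof.
rewrite reduced_region_boolE; apply: measurable_bool_set.
have m1 : measurable_fun setT (fun p : R * (R * R) => p.1) by exact: measurable_fst.
have m21 : measurable_fun setT (fun p : R * (R * R) => p.2.1).
  exact: measurableT_comp measurable_fst measurable_snd.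
have m22 : measurable_fun setT (fun p : R * (R * R) => p.2.2).
  exact: measurableT_comp measurable_snd measurable_snd.
have mn1 : measurable_fun setT (fun p : R * (R * R) => `|p.2.1|).
  exact: measurableT_comp.
have mn2 : measurable_fun setT (fun p : R * (R * R) => `|p.2.2|).
  exact: measurableT_comp.
apply: measurable_and; first exact: measurable_fun_ltr.
apply: measurable_and; first exact: measurable_fun_ler.
apply: measurable_and; apply: measurable_fun_ler => //.
  by apply: measurable_funD => //; apply: measurable_funM.
apply: measurable_funM; last exact: measurable_funX.
apply: measurable_funB => //; apply: measurable_funD; exact: measurable_funX.
Qed.

Lemma hexagonE (R : realType) (X Y : R) :
  hexagon (X, Y) <-> `|X| <= 1 / 2 /\ `|Y| <= half_height X.
Proof.
rewrite /hexagon /half_height/=; have q0 : 0 < Num.sqrt 3 :> R by rewrite sqrtr_gt0.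
by rewrite (ler_pdivlMr _ _ q0) lerBrDr (mulrC `|Y|).
Qed.

Lemma half_chord_sqr (R : realType) (X : R) :
  `|X| <= 1 / 2 -> half_chord X ^+ 2 = 1 - X ^+ 2.
Proof. by move=> /half_chord_gt0; rewrite sqrtr_gt0 => /ltW; exact: sqr_sqrtr. Qed.

(** At every abscissa the chord of the hexagon is shorter than that of the
    unit disk. *)
Lemma hexagon_sub_disk (R : realType) (X Y : R) :
  hexagon (X, Y) -> X ^+ 2 + Y ^+ 2 < 1.
Proof.
move=> /hexagonE[X2 Yb]; rewrite -ltrBrDl -half_chord_sqr// -(real_normK (num_real Y)).
have := half_chord_gt0 X2; have := half_height_lt_chord X2.
by have := normr_ge0 Y; nra.
Qed.

Lemma integral_cube_section (R : realType) (q : R * R) : hexagon q ->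
  (\int[lebesgue_measure]_(t in [set t | @reduced_region R (t, q)]) (t ^+ 3)%:E)%E =
  (1 / (4 * (1 - (q.1 ^+ 2 + q.2 ^+ 2))))%:E.
Proof.
case: q => X Y hq; have s1 := hexagon_sub_disk hq.
set s := X ^+ 2 + Y ^+ 2 in s1.
pose c : R := Num.sqrt (Num.sqrt ((1 - s)^-1)).
have s0 : 0 < 1 - s by lra.
have c0 : 0 < c by rewrite !sqrtr_gt0 invr_gt0.
have c4 : c ^+ 4 = (1 - s)^-1.
  by rewrite (exprM _ 2 2) !sqr_sqrtr ?sqrtr_ge0 ?invr_ge0 ?ltW.
have -> : [set t | @reduced_region R (t, (X, Y))] = `]0, c]%classic.
  rewrite reduced_region_boolE; apply/seteqP; split => t /=; rewrite in_itv/=.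
    move=> /and4P[t0 _ _]; rewrite -ler_pdivlMl// mulr1 -c4 t0/=.
    by rewrite ler_pXn2r ?nnegrE ?(ltW t0) ?(ltW c0).
  move=> /andP[t0 tc]; case: hq => /= -> ->; rewrite t0/= -/s.
  by rewrite -ler_pdivlMl// mulr1 -c4 ler_pXn2r ?nnegrE ?(ltW t0) ?(ltW c0).
rewrite integral_itv_obnd_cbnd; last by apply/measurable_EFinP; exact: measurable_funX.
have dF (t : R) : 0 <= t <= c ->
    is_derive t 1 (fun t => 4^-1 * t ^+ 4) (t ^+ 3).
  move=> _; rewrite (_ : t ^+ 3 = 4^-1 * (4 * t ^+ 3)); last by field.
  apply: is_derive_scalel.
  apply: (is_derive_eq (is_deriveX (f := id) 4 (is_derive_id t 1))).
  by rewrite /GRing.scale/= mulr1.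
rewrite (integral_is_derive c0 _ dF).
  by congr EFin; rewrite c4 expr0n/= -/s; field; lra.
by apply: continuous_subspaceT; exact: exprn_continuous.
Qed.

(** A primitive in [Y] of [1 / (4 (a^2 - Y^2))] is
    [(ln (a + Y) - ln (a - Y)) / (8 a)]. *)
Lemma integral_height (R : realType) (X : R) : `|X| <= 1 / 2 ->
  (\int[lebesgue_measure]_(Y in `[(- half_height X)%R, half_height X])
    (1 / (4 * (1 - (X ^+ 2 + Y ^+ 2))))%:E)%E = (hexagon_slice X)%:E.
Proof.
move=> X2; have a0 := half_chord_gt0 X2; have ba := half_height_lt_chord X2.
have b0 : 0 < half_height X by rewrite divr_gt0 ?sqrtr_gt0//; lra.
have a2 := half_chord_sqr X2.
set a := half_chord X in a0 ba a2 *; set b := half_height X in ba b0 *.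
pose F Y := (8 * a)^-1 * (ln (a + Y) - ln (a - Y)).
have disk Y : - b <= Y <= b -> 0 < 1 - (X ^+ 2 + Y ^+ 2).
  by move=> /andP[Y1 Y2]; rewrite opprD addrA -a2 subr_sqr mulr_gt0; lra.
have dF (Y : R) : - b <= Y <= b ->
    is_derive Y 1 F (1 / (4 * (1 - (X ^+ 2 + Y ^+ 2)))).
  move=> Yb; have := disk Y Yb; have /andP[Y1 Y2] := Yb => diskY.
  have p0 : 0 < a + Y by lra.
  have m0 : 0 < a - Y by lra.
  have -> : 1 / (4 * (1 - (X ^+ 2 + Y ^+ 2))) =
      (8 * a)^-1 * ((a + Y)^-1 - - (a - Y)^-1).
    rewrite (_ : 1 - _ = (a - Y) * (a + Y)); last by rewrite -subr_sqr a2; ring.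
    by field; rewrite !gt_eqF.
  apply: is_derive_scalel; apply: is_deriveB.
    under eq_fun do rewrite addrC.
    rewrite (addrC a); apply: (is_derive_translate (f := @ln R)).
    by apply: is_derive1_ln; rewrite addrC.
  by apply: (is_derive_reflect (f := @ln R)); exact: is_derive1_ln.
have nbb : - b < b by lra.
rewrite (integral_is_derive nbb _ dF).
  by congr EFin; rewrite /F /hexagon_slice -/a -/b opprK; field; lra.
apply: continuous_in_subspaceT => Y; rewrite inE/= in_itv/= => /disk Y0.
apply: cvgMl_tmp; apply: cvgV; first by rewrite mulf_neq0// gt_eqF.
apply: cvgMl_tmp; apply: cvgB; first exact: cvg_cst.
by apply: cvgD; [exact: cvg_cst|exact: exprn_continuous].
Qed.

Theorem proposition20 (R : realType) :
  (\int[@lebesgue_measure R \x (@lebesgue_measure R \x @lebesgue_measure R)]_(p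
      in @reduced_region R) (p.1 ^+ 3)%:E)%E =
  (1 / 4 * complex.Im (dilog ((1 +i* Num.sqrt (3 : R)) / 2)))%:E.
Proof.
rewrite integral_triple_sections.
- rewrite sixth_root_of_unity -integral_hexagon_slice [RHS]integral_mkcond.
  have sectionE X Y : (\int[lebesgue_measure]_(t in
      [set t | @reduced_region R (t, (X, Y))]) (t ^+ 3)%:E)%E =
      if `[< hexagon (X, Y) >] then (1 / (4 * (1 - (X ^+ 2 + Y ^+ 2))))%:E else 0%E.
    case: ifPn => [/asboolP/integral_cube_section//|/asboolPn nh].
    by rewrite [X in integral _ X _](_ : _ = set0) ?integral_set0// -subset0 => t [].
  apply: eq_integral => X _; rewrite patchE.
  under eq_integral do rewrite sectionE.
  case: ifPn => [|/negP]; rewrite inE/= in_itv/= -ler_norml => X2.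
    rewrite -integral_height// [RHS]integral_mkcond.
    apply: eq_integral => Y _; rewrite patchE; congr (if _ then _ else _).
    apply/asboolP/idP; rewrite hexagonE inE/= in_itv/= -ler_norml; first by case.
    by split.
  apply: integral0_eq => Y _; by case: ifPn => // /asboolP /hexagonE[/X2].
- exact: measurable_reduced_region.
- apply/measurable_EFinP; apply: measurable_funX; apply: measurable_funTS.
  exact: measurable_fst.
- by move=> p [/ltW p0 _ _]; rewrite lee_fin exprn_ge0.
Qed.
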